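(* Let $\mathscr{L} = [K,E]$ be the lattice of flats of a matroid of rank $r \ge 2$ on $E$, and let $i \in E \setminus K$. Then, as polynomials in $s,t$, $$ d(\mathscr{L})! \cdot \mathrm{vol}_\mathscr{L}(s\alpha_\mathscr{L} + t\beta_\mathscr{L}) = \sum_{\substack{K \le F < E\\ i \notin F}} \binom{d(\mathscr{L})}{r([K,F])} \, |\mu(K,F)| \, t^{r([K,F])} s^{d([F,E])},$$ where the sum is over flats $F$ with $K \le F < E$ and $i \notin F$.
   Context: $K$ is the set of loops (smallest flat), $\underline{\mathscr{L}} = \mathscr{L}\setminus\{K,E\}$. For flats $F \le G$, $[F,G]$ is the interval, itself the lattice of flats of a matroid; $r([F,G])$ is its rank (so $r([K,F])$ is the rank of $F$) and $d([F,G]) = r([F,G]) - 1$; $d(\mathscr{L}) = r - 1$. $\mu$ is the Möbius function of $\mathscr{L}$. $\alpha_\mathscr{L}, \beta_\mathscr{L} \in \mathbb{R}^{\underline{\mathscr{L}}}$ have entries $(\alpha_\mathscr{L})_F = |F\setminus K|/|E\setminus K|$ and $(\beta_\mathscr{L})_F = |E\setminus F|/|E\setminus K|$. The polynomial $\mathrm{vol}_\mathscr{L} \in \mathbb{R}[t_F : F \in \underline{\mathscr{L}}]$ is the unique homogeneous polynomial of degree $r-1$ such that: $\partial^S \mathrm{vol}_\mathscr{L} = 1$ for every maximal chain $S$ of $\underline{\mathscr{L}}$ and $\partial^S\mathrm{vol}_\mathscr{L} = 0$ for every set $S$ of $r-1$ flats that is not a chain (where $\partial^S = \prod_{F\in S}\partial_{t_F}$);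 $\mathrm{vol}_\mathscr{L}(\mathbf{t} + \mathbf{y}) = \mathrm{vol}_\mathscr{L}(\mathbf{t})$ for all modular $\mathbf{y}$, i.e. $\mathbf{y} = (\sum_{j \in F\setminus K} c_j)_{F}$ with $\sum_{j \in E\setminus K} c_j = 0$; $\partial^S\mathrm{vol}_\mathscr{L} \not\equiv 0$ exactly when $S$ is a chain; and $\mathrm{vol}_\mathscr{L}$ is strongly hereditary in the sense that for every chain $T$ every vector in $\mathbb{R}^T$ is the restriction of a modular vector. (When $r=2$, $\mathrm{vol}_\mathscr{L} = \sum_F t_F$.) *)

(* Defs.v *)
From HB Require Import structures.
From mathcomp Require Import all_boot all_order all_algebra.
From mathcomp.multinomials Require Import mpoly.

Set Implicit Arguments.
Unset Strict Implicit.
Unset Printing Implicit Defensive.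

Import GRing.Theory Num.Theory.
Local Open Scope ring_scope.

Record matroid (E : finType) := Matroid {
  indep : {set E} -> bool;
  indep0 : indep set0;
  indepS : forall I J : {set E}, I \subset J -> indep J -> indep I;
  indep_aug : forall I J : {set E}, indep I -> indep J -> (#|I| < #|J|)%N ->
    exists2 x, x \in J :\: I & indep (x |: I)
}.

Section Flats.
Variables (E : finType) (M : matroid E).

Definition rk (A : {set E}) : nat :=
  \max_(I : {set E} | indep M I && (I \subset A)) #|I|.

Definition matroid_rank : nat := rk [set: E].

Definition is_flat (F : {set E}) : bool :=
  [forall x, (x \notin F) ==> (rk F < rk (x |: F))%N].

Definition flats : {set {set E}} := [set F | is_flat F].

Definition loops : {set E} := [set x | ~~ indep M [set x]].

Definition proper_flats : {set {set E}} := flats :\: [set loops; [set: E]].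

(* For flats F <= G, the interval [F, G] is the lattice of flats of the minor
   (M | G) / F, whose rank is rk G - rk F. *)
Definition int_rank (F G : {set E}) : nat := rk G - rk F.

Definition int_dim (F G : {set E}) : nat := int_rank F G - 1.

Definition lattice_dim : nat := matroid_rank - 1.

(* Moebius function of the lattice of flats.  The fuel n bounds the length of
   the recursion; any n >= #|G| is enough, see mobiusE. *)
Fixpoint mobius_rec (n : nat) (F G : {set E}) : int :=
  if F == G then 1
  else if n is n'.+1 then
    - \sum_(H in flats | (F \subset H) && (H \proper G)) mobius_rec n' F H
  else 0.

Definition mobius (F G : {set E}) : int := mobius_rec #|G| F G.

Lemma mobius_rec_fuel n m (F G : {set E}) :
  (#|G| <= n)%N -> (#|G| <= m)%N -> mobius_rec n F G = mobius_rec m F G.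
Proof.
elim: n m G => [|n IHn] [|m] G //=.
- rewrite leqn0 cards_eq0 => /eqP -> _; case: eqP => // _.
  by rewrite big1 ?oppr0 // => H /and3P[_ _]; rewrite properE sub0set andbF.
- move=> _; rewrite leqn0 cards_eq0 => /eqP ->; case: eqP => // _.
  by rewrite big1 ?oppr0 // => H /and3P[_ _]; rewrite properE sub0set andbF.
move=> Gn Gm; case: eqP => // _; congr (- _); apply: eq_bigr => H.
case/and3P=> _ _ /proper_card HG.
by apply: IHn; rewrite -ltnS; apply: leq_trans HG _.
Qed.

Lemma mobiusE (F G : {set E}) : mobius F G =
  if F == G then 1
  else - \sum_(H in flats | (F \subset H) && (H \proper G)) mobius F H.
Proof.
rewrite /mobius (@mobius_rec_fuel #|G| #|G|.+1) //=.
case: eqP => // _; congr (- _); apply: eq_bigr => H /and3P[_ _ /proper_card HG].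
by apply: mobius_rec_fuel => //; apply: ltnW.
Qed.

Lemma card_le_rk (I A : {set E}) :
  indep M I -> I \subset A -> (#|I| <= rk A)%N.
Proof. by move=> iI sIA; apply: (bigmax_sup I); rewrite ?iI. Qed.

Lemma loops_flat : loops \in flats.
Proof.
rewrite inE; apply/forallP => x; apply/implyP; rewrite inE negbK => ix.
have -> : rk loops = 0%N.
  apply/eqP; rewrite -leqn0; apply/bigmax_leqP => I /andP[iI sI].
  rewrite leqn0 cards_eq0; apply/eqP/setP => y; rewrite [RHS]inE.
  apply/negP => yI; have := subsetP sI _ yI; rewrite inE => /negP; apply.
  by apply: indepS iI; rewrite sub1set.
by rewrite -(cards1 x) card_le_rk // sub1set setU11.
Qed.

Lemma loops_min (F : {set E}) : F \in flats -> loops \subset F.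
Proof.
rewrite inE => /forallP fF; apply/subsetP => x; rewrite inE => dx.
apply: contraT => xF; have /implyP/(_ xF) := fF x.
rewrite ltnNge; case/negP; apply/bigmax_leqP => I /andP[iI sI].
apply: card_le_rk => //.
apply/subsetP => y yI; have := subsetP sI _ yI; rewrite in_setU1.
case/orP => // /eqP yx; case/negP: dx; apply: indepS iI.
by rewrite sub1set -yx.
Qed.

End Flats.

Section Volume.
Variables (R : realFieldType) (E : finType) (M : matroid E).

(* Coordinates of R^(proper_flats M) and variables t_F are indexed by the
   positions of the proper flats in an enumeration of proper_flats M. *)
Notation pindex := 'I_#|proper_flats M|.

Definition pflat (i : pindex) : {set E} := enum_val i.

Definition alpha (i : pindex) : R :=
  #|pflat i :\: loops M|%:R / #|[set: E] :\: loops M|%:R.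

Definition beta (i : pindex) : R :=
  #|[set: E] :\: pflat i|%:R / #|[set: E] :\: loops M|%:R.

Definition is_chain (S : {set pindex}) : bool :=
  [forall i in S, forall j in S,
    (pflat i \subset pflat j) || (pflat j \subset pflat i)].

Definition is_maximal_chain (S : {set pindex}) : bool := maxset is_chain S.

Definition modular (y : pindex -> R) : Prop :=
  exists2 c : E -> R, \sum_(j in [set: E] :\: loops M) c j = 0 &
    forall i, y i = \sum_(j in pflat i :\: loops M) c j.

Definition partial (S : {set pindex}) (p : {mpoly R[#|proper_flats M|]}) :
    {mpoly R[#|proper_flats M|]} :=
  mderivm [multinom (i \in S : nat) | i < #|proper_flats M|] p.

Record is_vol (p : {mpoly R[#|proper_flats M|]}) : Prop := IsVol {
  vol_homog : p \is (matroid_rank M - 1).-homog;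
  vol_max_chain : forall S, is_maximal_chain S -> partial S p = 1;
  vol_non_chain : forall S : {set pindex},
    #|S| = (matroid_rank M - 1)%N -> ~~ is_chain S -> partial S p = 0;
  vol_modular : forall t y : pindex -> R,
    modular y -> p.@[fun i => t i + y i] = p.@[t];
  vol_chain : forall S, partial S p <> 0 <-> is_chain S;
  vol_strongly_hereditary : forall T : {set pindex}, is_chain T ->
    forall z : pindex -> R, exists2 y, modular y & {in T, y =1 z}
}.

End Volume.

(* Main.v *)
(* On R^N write D_w for the derivative in the direction w.  Invariance of vol
   under modular translations gives D_y vol = 0 for y modular, so on every
   partial derivative of vol the operator D_alpha acts as the sum of the d_F
   with i in F, and D_beta as the sum of the d_F with i not in F, for a non-loop
   i that may be chosen anew at each step.  Since d_S vol vanishes unless S is a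
   chain, taking i outside the top flat of a chain makes D_alpha extend the chain
   upwards, and taking i inside the bottom flat makes D_beta extend it downwards.
   Counting the available ranks kills all extensions that skip a rank: upwards
   only the cover of the top flat containing i survives, and downwards the
   surviving coatoms avoiding i add up to |mu| by Weisner's theorem.  As vol is
   homogeneous, the coefficient of s^(d-b) t^b in vol(s alpha + t beta) is
   D_alpha^(d-b) D_beta^b vol / (b! (d-b)!). *)
From HB Require Import structures.
Require Import Defs.
From mathcomp Require Import all_boot all_order all_algebra zify.
From mathcomp.multinomials Require Import mpoly.

Set Implicit Arguments.
Unset Strict Implicit.
Unset Printing Implicit Defensive.

Import GRing.Theory Num.Theory.
Local Open Scope ring_scope.

(** * Directional derivatives of multivariate polynomials *)

Section DirectionalDerivative.
Variables (R : comNzRingType) (n : nat).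
Implicit Types (w : 'I_n -> R) (p q : {mpoly R[n]}).

Definition dirderiv w p : {mpoly R[n]} := \sum_(k < n) w k *: p^`M(k).

Lemma dirderiv_is_linear w : linear (dirderiv w).
Proof.
move=> c p q; rewrite /dirderiv scaler_sumr -big_split /=.
apply: eq_bigr => k _.
by rewrite mderivD mderivZ scalerDr !scalerA mulrC.
Qed.

HB.instance Definition _ w := GRing.isLinear.Build R _ _ _
  (dirderiv w) (dirderiv_is_linear w).

Lemma dirderivM w p q :
  dirderiv w (p * q) = dirderiv w p * q + p * dirderiv w q.
Proof.
rewrite /dirderiv mulr_suml mulr_sumr -big_split /=; apply: eq_bigr => k _.
by rewrite mderivM scalerDr -scalerAl -scalerAr.
Qed.

Lemma dirderivC w c : dirderiv w c%:MP = 0.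
Proof. by rewrite /dirderiv big1 // => k _; rewrite mderivC scaler0. Qed.

Lemma dirderivX w k : dirderiv w 'X_k = (w k)%:MP.
Proof.
rewrite /dirderiv (bigD1 k) //= big1 => [|l lk].
  rewrite addr0 mderivX mnm1E eqxx scale1r -[X in (X - _)%MM]add0m addmK.
  by rewrite mpolyX0 alg_mpolyC.
by rewrite mderivX mnm1E eq_sym (negbTE lk) scale0r scaler0.
Qed.

Lemma mderiv_dirderiv w k p : (dirderiv w p)^`M(k) = dirderiv w p^`M(k).
Proof.
rewrite /dirderiv raddf_sum; apply: eq_bigr => l _ /=.
by rewrite mderivZ mderiv_comm.
Qed.

Lemma dirderiv_comm v w p :
  dirderiv v (dirderiv w p) = dirderiv w (dirderiv v p).
Proof.
rewrite {1}/dirderiv [dirderiv v p]/dirderiv raddf_sum; apply: eq_bigr => k _ /=.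
by rewrite mderiv_dirderiv linearZ.
Qed.

Lemma dirderivB v w p :
  dirderiv (fun k => v k - w k) p = dirderiv v p - dirderiv w p.
Proof.
rewrite /dirderiv -sumrB; apply: eq_bigr => k _; exact: scalerBl.
Qed.

Lemma eq_dirderiv v w p : v =1 w -> dirderiv v p = dirderiv w p.
Proof. by move=> vw; apply: eq_bigr => k _; rewrite vw. Qed.

Lemma iter_dirderiv_sum w a (I : finType) (P : pred I) (F : I -> {mpoly R[n]}) :
  iter a (dirderiv w) (\sum_(k | P k) F k)
  = \sum_(k | P k) iter a (dirderiv w) (F k).
Proof. by elim: a => //= a ->; rewrite raddf_sum. Qed.

Lemma iter_dirderiv0 w a : iter a (dirderiv w) 0 = 0.
Proof. by elim: a => //= a ->; rewrite raddf0. Qed.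

Lemma iter_dirderivC v w a b p :
  iter a (dirderiv v) (iter b (dirderiv w) p)
  = iter b (dirderiv w) (iter a (dirderiv v) p).
Proof.
elim: a => //= a ->; elim: b => //= b <-; exact: dirderiv_comm.
Qed.

Lemma mderivm_dirderiv w m p : mderivm m (dirderiv w p) = dirderiv w (mderivm m p).
Proof.
rewrite /mderivm; elim: (enum _) => //= k s ->.
by elim: (m k) => //= e ->; rewrite mderiv_dirderiv.
Qed.

End DirectionalDerivative.

(** Chain rule: both sides obey the Leibniz rule along the substitution, so agreement on constants
    and variables propagates to monomials. It serves for restriction to a line and for substitution
    of bivariate linear forms. *)
Lemma derivation_mmap (R A : comNzRingType) (n : nat) (f : {rmorphism R -> A})
    (h : 'I_n -> A) (w : 'I_n -> R) (D : {additive A -> A})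
    (DM : forall a b, D (a * b) = D a * b + a * D b)
    (Df : forall c, D (f c) = 0) (Dh : forall k, D (h k) = f (w k))
    (p : {mpoly R[n]}) :
  D (mmap f h p) = mmap f h (dirderiv w p).
Proof.
pose P q := D (mmap f h q) = mmap f h (dirderiv w q).
have PM q1 q2 : P q1 -> P q2 -> P (q1 * q2).
  rewrite /P => P1 P2.
  by rewrite dirderivM rmorphD !rmorphM /= DM P1 P2.
have P1 : P 1.
  by rewrite /P -mpolyC1 dirderivC mmapC Df mmap0.
have PX k : P 'X_k by rewrite /P dirderivX mmapX mmap1U mmapC Dh.
elim/mpolyind: p => [|c m p _ _ IHp]; first by rewrite !raddf0.
rewrite !raddfD /= -{}IHp; congr (_ + _).
rewrite linearZ /= !mmapZ DM Df mul0r add0r; congr (_ * _).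
rewrite mpolyXE_id; apply: (big_ind P) => // k _.
by elim: (m k) => [|e IHe] //; rewrite exprS; apply: PM.
Qed.

(** * Polynomial functions over an infinite field *)

Lemma poly_const_horner (R : realFieldType) (q : {poly R}) c :
  (forall x, q.[x] = c) -> q = c%:P.
Proof.
move=> qc; apply/eqP; rewrite -subr_eq0; apply/negPn/negP => q0.
(* Natural numbers are pairwise distinct in an ordered field, so they give one root more than the
   degree allows. *)
pose rs : seq R := [seq (k%:R : R) | k <- iota 0 (size (q - c%:P))].
have: (size rs < size (q - c%:P)%R)%N.
  apply: max_poly_roots => //.
    by apply/allP => x _; rewrite /root !hornerE qc subrr.
  rewrite map_inj_uniq ?iota_uniq // => i j /eqP.
  by rewrite eqr_nat => /eqP.
by rewrite size_map size_iota ltnn.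
Qed.

Section InfiniteField.
Variables (R : realFieldType) (n : nat).
Implicit Types (w t : 'I_n -> R) (p q : {mpoly R[n]}).

Lemma meval_line w t p x :
  (mmap polyC (fun k => (t k)%:P + (w k)%:P * 'X) p).[x]
  = p.@[fun k => t k + x * w k].
Proof.
rewrite /meval /mmap horner_sum; apply: eq_bigr => m _.
rewrite hornerM hornerC /mmap1 horner_prod; congr (_ * _).
by apply: eq_bigr => k _; rewrite horner_exp !hornerE [x * _]mulrC.
Qed.

(** Restricted to the line, [p] is a univariate polynomial with constant values, hence a constant;
    by the chain rule its derivative at 0 is the directional derivative at [t]. *)
Lemma dirderiv_const_line w t p c :
  (forall x, p.@[fun k => t k + x * w k] = c) -> (dirderiv w p).@[t] = 0.
Proof.
move=> pc; set L := fun k => (t k)%:P + (w k)%:P * 'X.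
have D0 : (mmap polyC L p)^`() = 0.
  rewrite (@poly_const_horner _ (mmap polyC L p) c) ?derivC // => x.
  by rewrite meval_line.
have := @derivation_mmap R _ n polyC L w deriv.
move=> /(_ (@derivM _) (@derivC _)) Dp.
have {Dp} : (mmap polyC L p)^`() = mmap polyC L (dirderiv w p).
  apply: Dp => k /=; rewrite /L derivD derivC add0r derivM derivC mul0r add0r.
  by rewrite derivX mulr1.
rewrite D0 => /(congr1 (fun q : {poly R} => q.[0])).
rewrite horner0 meval_line => /esym; congr (_ = _).
by apply: meval_eq => k; rewrite mul0r addr0.
Qed.

Lemma meval_at0 p : p.@[fun=> 0] = p@_0%MM.
Proof.
elim/mpolyind: p => [|c m p _ _ IHp]; first by rewrite meval0 mcoeff0.
rewrite mevalD mevalZ mevalX mcoeffD mcoeffZ mcoeffX IHp -mdeg_eq0 mdegE.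
rewrite sum_nat_eq0; congr (_ * _ + _).
have [m0|/existsP[k /= mk]] := altP forallP.
  by rewrite big1 // => k _; have /eqP -> := m0 k.
by rewrite (bigD1 k) //= expr0n (negbTE mk) mul0r.
Qed.

(** Induction on the degree of the monomial: a coefficient of positive degree is, up to a nonzero
    integer factor, a coefficient of some partial derivative, which again vanishes everywhere
    because [p] is constant on lines. *)
Lemma mpoly_eq0 p : (forall t, p.@[t] = 0) -> p = 0.
Proof.
move=> p0; apply/mpolyP => m; rewrite mcoeff0.
move e: (mdeg m) => d; elim: d m p e p0 => [|d IHd] m p e p0.
  by move/eqP: e; rewrite mdeg_eq0 => /eqP ->; rewrite -meval_at0.
have /existsP[k mk] : [exists k, m k != 0%N].
  rewrite -negb_forall; apply/negP => /forallP m0.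
  by move: e; rewrite mdegE big1 // => k _; apply/eqP.
have mE : m = ((m - U_(k)) + U_(k))%MM.
  by rewrite submK // lep1mP.
have /eqP : (p^`M(k))@_(m - U_(k)) = 0.
  apply: IHd.
    by apply/eqP; rewrite -eqSS -e [in X in _ == X]mE mdegD mdeg1 addn1.
  move=> t; have <- : dirderiv (fun l => (l == k)%:R) p = p^`M(k).
    rewrite /dirderiv (bigD1 k) //= eqxx scale1r big1 ?addr0 // => l lk.
    by rewrite (negbTE lk) scale0r.
  exact: dirderiv_const_line.
by rewrite mcoeff_mderiv -mE mulrn_eq0 => /eqP.
Qed.

End InfiniteField.

(** * Substitution of linear forms in two variables *)

Section LinearSubstitution.
Variables (R : comNzRingType) (n : nat).
Implicit Types (p : {mpoly R[n]}).

Lemma dhomog_comp_mpoly k (lq : n.-tuple {mpoly R[k]}) d p :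
  p \is d.-homog -> (forall l, tnth lq l \is 1.-homog) -> p \mPo lq \is d.-homog.
Proof.
move=> hp hlq; rewrite comp_mpolyEX big_seq.
apply: rpred_sum => m mp; apply: dhomogZ; rewrite comp_mpolyX.
rewrite -(dhomog_mf hp mp) /= mdegE.
apply: (big_ind2 (fun (q : {mpoly R[k]}) e => q \is e.-homog)) =>
  [|q1 e1 q2 e2 h1 h2|l _].
- exact: dhomog1.
- exact: dhomogM.
by rewrite -[X in X.-homog]mul1n; apply: dhomogMn.
Qed.

Variables v w : 'I_n -> R.
Let lq := [tuple v k *: ('X_0 : {mpoly R[2]}) + w k *: 'X_1 | k < n].

Lemma mderiv0_comp_linear p : (p \mPo lq)^`M(0) = dirderiv v p \mPo lq.
Proof.
apply: (@derivation_mmap _ _ _ (@mpolyC 2 R) _ _ (mderiv 0)) => [a b|c|k] /=.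
- exact: mderivM.
- exact: mderivC.
rewrite tnth_mktuple mderivD !mderivZ !mderivX !mnm1E /= scale0r scaler0 addr0.
by rewrite scale1r -[X in (X - _)%MM]add0m addmK mpolyX0 alg_mpolyC.
Qed.

Lemma mderiv1_comp_linear p : (p \mPo lq)^`M(1) = dirderiv w p \mPo lq.
Proof.
apply: (@derivation_mmap _ _ _ (@mpolyC 2 R) _ _ (mderiv 1)) => [a b|c|k] /=.
- exact: mderivM.
- exact: mderivC.
rewrite tnth_mktuple mderivD !mderivZ !mderivX !mnm1E /= scale0r scaler0 add0r.
by rewrite scale1r -[X in (X - _)%MM]add0m addmK mpolyX0 alg_mpolyC.
Qed.

(** Taylor's formula: differentiating moves the coefficient to the constant term at the cost of two
    factorials, and the chain rule turns the bivariate derivatives into directional ones. *)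
Lemma mcoeff_comp_linear p a b :
  (p \mPo lq)@_(U_(1) *+ b + U_(0) *+ a) *+ (b`! * a`!)
  = (iter a (dirderiv v) (iter b (dirderiv w) p) \mPo lq)@_0%MM.
Proof.
have -> : iter a (dirderiv v) (iter b (dirderiv w) p) \mPo lq
    = (p \mPo lq)^`M[U_(1) *+ b + U_(0) *+ a].
  rewrite mderivmDm !mderivn_iter.
  elim: a => [|a IHa] /=; last by rewrite -mderiv0_comp_linear IHa.
  by elim: b => //= b IHb; rewrite -mderiv1_comp_linear IHb.
rewrite mcoeff_mderivm addm0; congr (_ *+ _).
rewrite !big_ord_recl big_ord0 !mnmDE !mulmnE !mnm1E /= muln1.
by rewrite !mul0n !mul1n add0n addn0 !ffactnn mulnC.
Qed.

End LinearSubstitution.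

(** * Flats and the Moebius function *)

Section MatroidClosure.
Variables (E : finType) (M : matroid E).
Implicit Types (A B F G I J : {set E}) (x y : E).
Local Notation rk := (rk M).
Local Notation K := (loops M).

Lemma rkS A B : A \subset B -> (rk A <= rk B)%N.
Proof.
move=> AB; apply/bigmax_leqP => I /andP[iI IA].
by apply: card_le_rk => //; apply: subset_trans AB.
Qed.

Lemma extend_to_basis I A : indep M I -> I \subset A ->
  exists J, [/\ indep M J, I \subset J, J \subset A & #|J| = rk A].
Proof.
move=> iI IA; pose P J := [&& indep M J, I \subset J & J \subset A].
have PI : P I by rewrite /P iI subxx IA.
have [J /and3P[iJ IJ JA] maxJ] := arg_maxnP (fun J : {set E} => #|J|) PI.
exists J; split=> //; apply/eqP; rewrite eqn_leq card_le_rk //=.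
apply/bigmax_leqP => B /andP[iB BA]; rewrite leqNgt; apply/negP => JB.
have [x /setDP[xB xJ] ixJ] := indep_aug iJ iB JB.
have /maxJ : P (x |: J).
  rewrite /P ixJ (subset_trans IJ) ?subsetUr // subUset sub1set JA.
  by rewrite (subsetP BA).
by rewrite /= cardsU1 xJ add1n ltnn.
Qed.

Lemma basis_exists A : exists J, [/\ indep M J, J \subset A & #|J| = rk A].
Proof.
by have [J [iJ _ JA cJ]] := extend_to_basis (indep0 M) (sub0set A); exists J.
Qed.

Lemma rkU1 x A : (rk (x |: A) <= (rk A).+1)%N.
Proof.
apply/bigmax_leqP => I /andP[iI IxA].
apply: leq_trans (_ : #|x |: (I :\ x)| <= _)%N.
  by apply: subset_leq_card; apply/subsetP => y; rewrite !inE; case: eqVneq.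
apply: leq_trans (leq_card_setU _ _) _; rewrite cards1 add1n ltnS.
apply: card_le_rk; first by apply: indepS iI; apply: subsetDl.
by apply/subsetP => y /setD1P[yx /(subsetP IxA)/setU1P[/eqP|//]]; rewrite (negbTE yx).
Qed.

(** The smallest flat containing [A], described by rank; see [closure_flat] and [closure_min]. *)
Definition closure A : {set E} := [set x | rk (x |: A) == rk A].

Lemma sub_closure A : A \subset closure A.
Proof. by apply/subsetP => x xA; rewrite inE (setUidPr _) ?sub1set. Qed.

(** Otherwise a basis of [A] could be augmented by some [x] in the closure, making the rank of
    [x |: A] exceed that of [A]. *)
Lemma rk_closure A : rk (closure A) = rk A.
Proof.
apply/eqP; rewrite eqn_leq (rkS (sub_closure A)) andbT leqNgt; apply/negP => lt.
have [I [iI IA cI]] := basis_exists A.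
have [J [iJ JA cJ]] := basis_exists (closure A).
move: lt; rewrite -cI -cJ => /(indep_aug iI iJ)[x /setDP[xJ xI] ixI].
have := subsetP JA _ xJ; rewrite inE => /eqP rx.
have : (#|x |: I| <= rk (x |: A))%N by apply: card_le_rk => //; apply: setUS.
by rewrite rx cardsU1 xI -cI add1n ltnn.
Qed.

Lemma flatP F : reflect (forall x, x \notin F -> (rk F < rk (x |: F))%N)
  (F \in flats M).
Proof.
rewrite inE; apply: (iffP forallP) => H x; first by move/implyP: (H x).
by apply/implyP; apply: H.
Qed.

Lemma closure_flat A : closure A \in flats M.
Proof.
apply/flatP => x xA; rewrite rk_closure.
apply: leq_trans (_ : rk (x |: A) <= _)%N; last by apply/rkS/setUS/sub_closure.
by rewrite ltn_neqAle eq_sym rkS ?subsetUr // andbT; rewrite inE in xA.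
Qed.

Lemma setT_flat : [set: E] \in flats M.
Proof. by apply/flatP => x; rewrite inE. Qed.

(** If [x] were outside [F], a basis of [A] extended to a basis of [F] could be augmented inside
    [x |: F]. The new element cannot lie in [F], so it is [x]; but [x] does not raise the rank of
    [A]. *)
Lemma closure_min A F : F \in flats M -> A \subset F -> closure A \subset F.
Proof.
move=> /flatP fF AF; apply/subsetP => x; rewrite inE => /eqP rx.
apply: contraT => /[dup] xF /fF rF.
have [I [iI IA cI]] := basis_exists A.
have [I' [iI' II' I'F cI']] := extend_to_basis iI (subset_trans IA AF).
have [J [iJ JF cJ]] := basis_exists (x |: F).
move: rF; rewrite -cI' -cJ => /(indep_aug iI' iJ)[y /setDP[yJ yI'] iyI'].
have [yx|yF] := setU1P (subsetP JF _ yJ).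
  have : (#|x |: I| <= rk (x |: A))%N.
    by apply: card_le_rk; [apply: indepS iyI'; rewrite yx; apply: setUS|apply: setUS].
  rewrite rx cardsU1 -cI; case: (boolP (x \in I)) => [xI|_]; last by rewrite add1n ltnn.
  by case/negP: xF; apply: subsetP (subset_trans IA AF) _ xI.
have : (#|y |: I'| <= rk F)%N.
  by apply: card_le_rk => //; rewrite subUset sub1set yF.
by rewrite cardsU1 yI' -cI' add1n ltnn.
Qed.

Lemma rk_flat_proper F G : F \in flats M -> F \proper G -> (rk F < rk G)%N.
Proof.
move=> /flatP fF /properP[FG [x xG xF]]; apply: leq_trans (fF _ xF) (rkS _).
by rewrite subUset sub1set xG.
Qed.

Lemma rk_flat_inj F G :
  F \in flats M -> F \subset G -> rk F = rk G -> F = G.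
Proof.
move=> fF FG rFG; apply/eqP; rewrite eqEproper FG /=.
by apply/negP => /(rk_flat_proper fF); rewrite rFG ltnn.
Qed.

Lemma rk_loops : rk K = 0%N.
Proof.
apply/eqP; rewrite -leqn0; apply/bigmax_leqP => I /andP[iI IK].
rewrite leqn0 cards_eq0; apply/eqP/setP => x; rewrite [RHS]inE.
apply/negP => xI; have := subsetP IK _ xI; rewrite inE => /negP; apply.
by apply: indepS iI; rewrite sub1set.
Qed.

Lemma rk_flat_eq0 F : F \in flats M -> (rk F == 0%N) = (F == K).
Proof.
move=> fF; apply/eqP/eqP => [rF|->]; last exact: rk_loops.
by apply/esym/rk_flat_inj; rewrite ?loops_flat ?loops_min ?rk_loops.
Qed.

Lemma rk_flatU1 x F : F \in flats M -> x \notin F -> rk (x |: F) = (rk F).+1.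
Proof. by move=> /flatP fF /fF lt; apply/eqP; rewrite eqn_leq rkU1. Qed.

(** The join of [F] with an outside point [x] is the unique cover of [F] containing [x], covers
    being detected by rank. *)
Lemma flat_coverE x F G : F \in flats M -> G \in flats M -> x \notin F ->
  (G == closure (x |: F)) = [&& x \in G, F \proper G & rk G == (rk F).+1].
Proof.
move=> fF fG xF; apply/eqP/and3P => [->|[xG FG /eqP rG]].
  have sub := sub_closure (x |: F).
  have xcl : x \in closure (x |: F) by apply: (subsetP sub); rewrite setU11.
  rewrite rk_closure rk_flatU1 //; split=> //; apply/properP; split.
    by apply: subset_trans sub; apply: subsetUr.
  by exists x.
apply/esym/rk_flat_inj; first exact: closure_flat.
  by apply: closure_min => //; rewrite subUset sub1set xG proper_sub.
by rewrite rk_closure rk_flatU1.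
Qed.

(** * Alternating signs of the Moebius function *)

Local Notation mu := (mobius M K).

Lemma sum_mobius G : G \in flats M -> G != K ->
  \sum_(F in flats M | F \subset G) mu F = 0.
Proof.
move=> fG GK; rewrite (bigD1 G) /= ?fG ?subxx // mobiusE eq_sym (negbTE GK).
apply/eqP; rewrite addrC subr_eq0; apply/eqP.
apply: eq_bigl => F; rewrite properEneq.
case fF: (F \in flats M) => //=; rewrite loops_min //= andbC.
by case: (F != G) => //; case: (F \subset G).
Qed.

(* The sum of [mu] over all flats below [G] splits according to the join of a
   flat with [x]; the parts strictly below [G] vanish by induction. *)
Lemma sum_mobius_join x G : G \in flats M -> x \in G -> x \notin K ->
  \sum_(F in flats M | closure (x |: F) == G) mu F = 0.
Proof.
move: {2}#|G|.+1 (ltnSn #|G|) => n; elim: n G => // n IHn G ltGn fG xG xK.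
have GK : G != K by apply: contraNneq xK => <-.
have closE F : F \in flats M ->
    (F \subset G) = (closure (x |: F) \subset G).
  move=> fF; apply/idP/idP => [FG|].
    by apply: closure_min; rewrite // subUset sub1set xG.
  by apply: subset_trans; apply: subset_trans (sub_closure _); apply: subsetUr.
have := sum_mobius fG GK.
rewrite (partition_big (fun F => closure (x |: F))
  (fun H => [&& H \in flats M, x \in H & H \subset G])) /=; last first.
  move=> F /andP[fF FG]; rewrite closure_flat -closE // FG andbT.
  by apply: (subsetP (sub_closure _)); apply: setU11.
rewrite (bigD1 G) /= ?fG ?xG ?subxx // [X in _ + X]big1 ?addr0 => [sG|H].
  rewrite -[RHS]sG; apply: eq_bigl => F; case fF: (F \in flats M) => //=.
  by have [e|] := eqVneq; rewrite ?andbF // closE // e subxx.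
case/andP=> /and3P[fH xH HG] neHG; rewrite -[RHS](IHn H) //.
  apply: eq_bigl => F; case fF: (F \in flats M) => //=.
  by have [e|] := eqVneq; rewrite ?andbF // closE // e HG.
have HpG : H \proper G by rewrite properEneq neHG.
by apply: leq_trans (proper_card HpG) _; rewrite -ltnS.
Qed.

Definition coatoms_avoiding x G : {set {set E}} :=
  [set F in flats M | [&& x \notin F, F \proper G & rk G == (rk F).+1]].

(* Weisner's theorem for the atom [closure [set x]]. *)
Lemma mobius_coatoms x G : G \in flats M -> x \in G -> x \notin K ->
  mu G = - \sum_(F in coatoms_avoiding x G) mu F.
Proof.
move=> fG xG xK; have := sum_mobius_join fG xG xK.
have clG F : F \in flats M -> x \in F -> closure (x |: F) = F.
  move=> fF xF; apply/eqP; rewrite eqEsubset closure_min ?subUset ?sub1set ?xF //=.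
  by apply: subset_trans (sub_closure _); apply: subsetUr.
rewrite (bigD1 G) /= ?fG ?clG ?eqxx // => /eqP; rewrite addr_eq0 => /eqP ->.
congr (- _); apply: eq_bigl => F; rewrite [RHS]inE.
case fF: (F \in flats M) => //=; have [xF|xF] := boolP (x \in F).
  by rewrite clG // andbN.
rewrite eq_sym flat_coverE // xG /=; case: properP => //= FG.
by rewrite andbC; case: eqVneq FG => // -> /properP; rewrite properxx.
Qed.

(** All coatoms have rank one less than [G], so the terms in Weisner's sum share one sign and
    nothing cancels. The premise on signs is the induction hypothesis of [mobius_sign]. *)
Lemma mobius_coatoms_sign x G :
  (forall F, F \in coatoms_avoiding x G -> mu F = (-1) ^+ rk F * `|mu F|%N%:Z) ->
  G \in flats M -> x \in G -> x \notin K ->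
  mu G = (-1) ^+ rk G * (\sum_(F in coatoms_avoiding x G) `|mu F|%N)%N%:Z.
Proof.
move=> signF fG xG xK; rewrite (mobius_coatoms fG xG xK).
rewrite -[X in _ = _ * X]natz natr_sum mulr_sumr -sumrN.
apply: eq_bigr => F FG; rewrite {1}signF // natz.
by move: FG; rewrite inE => /and4P[_ _ _ /eqP ->]; rewrite exprS mulN1r mulNr.
Qed.

Lemma mobius_sign G : G \in flats M -> mu G = (-1) ^+ rk G * `|mu G|%N%:Z.
Proof.
move e : (rk G) => n; elim: n G e => [|n IHn] G rG fG.
  move/eqP: rG; rewrite rk_flat_eq0 // => /eqP ->.
  by rewrite mobiusE eqxx.
(* Positive rank provides the non-loop in [G] that Weisner's theorem requires. *)
have [x xG xK] : exists2 x, x \in G & x \notin K.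
  apply/subsetPn; apply/negP => GK.
  by have := rkS GK; rewrite rG rk_loops.
rewrite (mobius_coatoms_sign _ fG xG xK) ?rG ?abszMsign // => F.
rewrite inE => /and4P[fF _ _]; rewrite rG eqSS => /eqP rF.
by rewrite -rF; apply: IHn.
Qed.

(** This sign-free recursion is the one that [D_beta] reproduces on chains. *)
Lemma absz_mobius_coatoms x G : G \in flats M -> x \in G -> x \notin K ->
  `|mu G|%N = (\sum_(F in coatoms_avoiding x G) `|mu F|)%N.
Proof.
move=> fG xG xK; rewrite (mobius_coatoms_sign _ fG xG xK) ?abszMsign // => F.
by rewrite inE => /andP[fF _]; apply: mobius_sign.
Qed.

End MatroidClosure.

(** * Derivatives of the volume polynomial along chains of flats *)

Section ProperFlats.
Variables (E : finType) (M : matroid E).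
Implicit Types (F G H : {set E}) (j k l : 'I_#|proper_flats M|).
Implicit Types (T : {set 'I_#|proper_flats M|}).
Local Notation rk := (rk M).
Local Notation K := (loops M).
Local Notation d := (lattice_dim M).

Lemma pflat_flat k : pflat k \in flats M.
Proof. by have := enum_valP k; rewrite in_setD => /andP[]. Qed.

Lemma pflat_loops k : K \proper pflat k.
Proof.
rewrite properEneq loops_min ?pflat_flat // andbT eq_sym.
by have := enum_valP k; rewrite in_setD in_set2 negb_or => /andP[/andP[]].
Qed.

Lemma pflat_setT k : pflat k \proper [set: E].
Proof.
rewrite properT.
by have := enum_valP k; rewrite in_setD in_set2 negb_or => /andP[/andP[]].
Qed.

Lemma rk_pflat_gt0 k : (0 < rk (pflat k))%N.
Proof.
by have := rk_flat_proper (loops_flat M) (pflat_loops k); rewrite rk_loops.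
Qed.

Lemma rk_pflat_le k : (rk (pflat k) <= d)%N.
Proof.
have := rk_flat_proper (pflat_flat k) (pflat_setT k).
rewrite /lattice_dim /matroid_rank; lia.
Qed.

Lemma pflat_inj : injective (@pflat E M).
Proof. exact: enum_val_inj. Qed.

Lemma proper_flatsE F :
  (F \in proper_flats M) = (F \in flats M) && (0 < rk F <= d)%N.
Proof.
apply/idP/andP => [Fp|[fF /andP[rF0 rFd]]].
  have <- : pflat (enum_rank_in Fp F) = F by rewrite /pflat enum_rankK_in.
  by rewrite pflat_flat rk_pflat_gt0 rk_pflat_le.
rewrite in_setD fF in_set2 andbT; apply/norP; split.
  by rewrite -rk_flat_eq0 // -lt0n.
apply/eqP => FE; move: rF0 rFd; rewrite FE /lattice_dim /matroid_rank; lia.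
Qed.

Lemma pflat_exists F : F \in flats M -> (0 < rk F <= d)%N ->
  exists k, pflat k = F.
Proof.
move=> fF rF; have Fp : F \in proper_flats M by rewrite proper_flatsE fF.
by exists (enum_rank_in Fp F); rewrite /pflat enum_rankK_in.
Qed.

Lemma sum_pflat (V : nmodType) (P : pred {set E}) (f : {set E} -> V) :
  \sum_(k | P (@pflat E M k)) f (pflat k) = \sum_(F in proper_flats M | P F) f F.
Proof. by rewrite [RHS]big_enum_val_cond. Qed.

Lemma chainP T : reflect {in T &, forall j k,
    (pflat j \subset pflat k) || (pflat k \subset pflat j)} (is_chain T).
Proof.
apply: (iffP forall_inP) => H j; first by move=> k jT; have /forall_inP := H j jT; apply.
by move=> jT; apply/forall_inP => k; exact: H.
Qed.

(** Rank is injective on a chain. Its values among the [d + 1] numbers from 0 to [d] miss 0, which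
    gives the bound [d]. *)
Lemma chain_card T : is_chain T -> (#|T| <= d)%N.
Proof.
move=> /chainP chT.
pose f k : 'I_d.+1 := inord (rk (pflat k)).
have f_val k : f k = rk (pflat k) :> nat by rewrite inordK // ltnS rk_pflat_le.
have f_inj : {in T &, injective f}.
  move=> j k jT kT /(congr1 val) /=; rewrite !f_val => rjk; apply: pflat_inj.
  case/orP: (chT _ _ jT kT) => [jk|kj]; first exact: rk_flat_inj (pflat_flat _) jk rjk.
  exact/esym/(rk_flat_inj (pflat_flat _) kj)/esym.
rewrite -(card_in_imset f_inj) -ltnS -[X in (_ < X)%N]card_ord -cardsT.
apply: proper_card; rewrite properT; apply/eqP => fT.
have /imsetP[k _ /(congr1 val) /= /esym] : ord0 \in f @: T by rewrite fT inE.
by rewrite f_val => /eqP; rewrite -leqn0 leqNgt rk_pflat_gt0.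
Qed.

Lemma chainU1 k T : is_chain T ->
  (forall j, j \in T -> (pflat j \subset pflat k) || (pflat k \subset pflat j)) ->
  is_chain (k |: T).
Proof.
move=> /chainP chT kT; apply/chainP => j l /setU1P[->|jT] /setU1P[->|lT].
- by rewrite subxx.
- by rewrite orbC kT.
- by rewrite kT.
- exact: chT.
Qed.

(* The empty chain has top [K] and bottom [E]. *)
Definition is_top T G :=
  (forall j, j \in T -> pflat j \subset G) /\
  (G = K \/ exists2 j, j \in T & pflat j = G).

Definition is_bottom T G :=
  (forall j, j \in T -> G \subset pflat j) /\
  (G = [set: E] \/ exists2 j, j \in T & pflat j = G).

Lemma top_flat T G : is_top T G -> G \in flats M.
Proof. by case=> _ [->|[j _ <-]]; [apply: loops_flat|apply: pflat_flat]. Qed.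

Lemma bottom_flat T G : is_bottom T G -> G \in flats M.
Proof. by case=> _ [->|[j _ <-]]; [apply: setT_flat|apply: pflat_flat]. Qed.

Lemma top_rk T G : is_top T G -> (rk G <= d)%N.
Proof. by case=> _ [->|[j _ <-]]; [rewrite rk_loops|apply: rk_pflat_le]. Qed.

Lemma topU1 k T G : is_top T G -> G \proper pflat k -> is_top (k |: T) (pflat k).
Proof.
move=> [TG _] Gk; split; last by right; exists k; rewrite ?setU11.
by move=> j /setU1P[->//|/TG/subset_trans]; apply; apply: proper_sub.
Qed.

Lemma bottomU1 k T G :
  is_bottom T G -> pflat k \proper G -> is_bottom (k |: T) (pflat k).
Proof.
move=> [TG _] kG; split; last by right; exists k; rewrite ?setU11.
by move=> j /setU1P[->//|/TG]; apply: subset_trans; apply: proper_sub.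
Qed.

Lemma bottom_sub_top T G H :
  is_bottom T G -> is_top T H -> T != set0 -> G \subset H.
Proof.
by move=> [GT _] [TH _] /set0Pn[k kT]; apply: subset_trans (GT k kT) (TH k kT).
Qed.

(** Nonemptiness matters: the top [K] of the empty chain would change when a flat is added. *)
Lemma topU1_below k T G H :
  is_top T H -> is_bottom T G -> T != set0 -> pflat k \proper G ->
  is_top (k |: T) H.
Proof.
move=> topH botG T0 kG; have [TH HT] := topH; split.
  move=> j /setU1P[->|/TH //].
  exact: subset_trans (proper_sub kG) (bottom_sub_top botG topH T0).
by case: HT => [|[j jT jH]]; [left|right; exists j; rewrite // in_setU1 jT orbT].
Qed.

Lemma chainU1_top k T G :
  is_chain T -> is_top T G -> G \proper pflat k -> is_chain (k |: T).
Proof.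
move=> chT [TG _] Gk; apply: chainU1 => // j /TG jG.
by rewrite (subset_trans jG) // proper_sub.
Qed.

Lemma chainU1_bottom k T G :
  is_chain T -> is_bottom T G -> pflat k \proper G -> is_chain (k |: T).
Proof.
move=> chT [TG _] kG; apply: chainU1 => // j /TG Gj.
by rewrite orbC (subset_trans _ Gj) // proper_sub.
Qed.

Hypothesis rank_ge2 : (2 <= matroid_rank M)%N.

Lemma bottom_rk T G : is_bottom T G -> (0 < rk G)%N.
Proof.
case=> _ [->|[j _ <-]]; last exact: rk_pflat_gt0.
by move: rank_ge2; rewrite /matroid_rank; lia.
Qed.

Lemma top_avoided T G : is_top T G -> exists2 x, x \notin K & x \notin G.
Proof.
move=> topG; have rG := top_rk topG.
have [x _ xG] : exists2 x, x \in [set: E] & x \notin G.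
  apply/subsetPn; apply/negP => /(rkS M); move: rG rank_ge2.
  rewrite /lattice_dim /matroid_rank; lia.
by exists x => //; apply: contraNN xG; apply/subsetP/loops_min/(top_flat topG).
Qed.

Lemma bottom_member T G : is_bottom T G -> exists2 x, x \notin K & x \in G.
Proof.
move=> botG; have rG := bottom_rk botG.
have [x xG xK] : exists2 x, x \in G & x \notin K.
  by apply/subsetPn; apply/negP => /(rkS M); rewrite rk_loops leqNgt rG.
by exists x.
Qed.

Lemma max_chain T : is_chain T -> #|T| = d -> is_maximal_chain T.
Proof.
move=> chT cT; apply/maxsetP; split=> // S chS TS.
by apply/eqP; rewrite eq_sym eqEcard TS cT chain_card.
Qed.

(** The only coatom below a flat of rank one is [K]; this is the base case of the downward
    recursion. *)
Lemma absz_mobius_rk1 G : G \in flats M -> rk G = 1%N -> `|mobius M K G|%N = 1%N.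
Proof.
move=> fG rG; have [x xG xK] : exists2 x, x \in G & x \notin K.
  by apply/subsetPn; apply/negP => /(rkS M); rewrite rk_loops rG.
rewrite (absz_mobius_coatoms fG xG xK) (big_pred1 K).
  by rewrite mobiusE eqxx.
move=> F; rewrite [LHS]inE rG eqSS [0%N == _]eq_sym.
apply/and4P/eqP => [[fF _ _]|->]; first by rewrite rk_flat_eq0 // => /eqP.
rewrite loops_flat rk_loops xK properE loops_min //=.
by split=> //; apply/subsetPn; exists x.
Qed.

End ProperFlats.

(** * The operators [D_alpha] and [D_beta] on derivatives along chains *)

Section VolumeDerivatives.
Variables (R : realFieldType) (E : finType) (M : matroid E).
Hypothesis rank_ge2 : (2 <= matroid_rank M)%N.
Variable vol : {mpoly R[#|proper_flats M|]}.
Hypothesis vol_is_vol : is_vol vol.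
Implicit Types (F G H : {set E}) (j k l : 'I_#|proper_flats M|).
Implicit Types (T : {set 'I_#|proper_flats M|}).
Local Notation rk := (rk M).
Local Notation K := (loops M).
Local Notation d := (lattice_dim M).
Local Notation D_alpha := (dirderiv (@alpha R E M)).
Local Notation D_beta := (dirderiv (@beta R E M)).
Local Notation "\d_ T" := (partial T vol).

Lemma partial0 : \d_(set0) = vol.
Proof.
rewrite /partial -[RHS]mderivm0m; congr mderivm.
by apply/mnmP => k; rewrite mnmE in_set0 mnm0E.
Qed.

Lemma partialU1 k T : k \notin T -> (\d_T)^`M(k) = \d_(k |: T).
Proof.
move=> kT; rewrite /partial -mderivmU1m -mderivmDm; congr mderivm.
apply/mnmP => l; rewrite mnmDE !mnmE in_setU1 [k == l]eq_sym.
by case: (eqVneq l k) kT => [->|_ _]; rewrite ?addn0 // => /negbTE ->.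
Qed.

Lemma partial_nonchain T : ~~ is_chain T -> \d_T = 0.
Proof.
move=> chT; apply/eqP; apply: contraNT chT => /eqP.
by move/(vol_chain vol_is_vol).
Qed.

(** Multiples of a modular vector are modular, so [vol] is constant on lines in that direction; the
    directional derivative then commutes past the partial ones. *)
Lemma dirderiv_modular y T : modular y -> dirderiv y \d_T = 0.
Proof.
case=> c c0 yc; rewrite /partial -mderivm_dirderiv.
suff -> : dirderiv y vol = 0 by rewrite raddf0.
apply: mpoly_eq0 => t; apply: (@dirderiv_const_line _ _ _ _ _ vol.@[t]) => x.
apply: (vol_modular vol_is_vol); exists (fun e => x * c e).
  by rewrite -mulr_sumr c0 mulr0.
by move=> k; rewrite yc mulr_sumr.
Qed.

Lemma card_nonloops_neq0 : #|[set: E] :\: K|%:R != 0 :> R.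
Proof.
rewrite pnatr_eq0 cards_eq0 setD_eq0; apply/negP => /(rkS M).
by move: rank_ge2; rewrite /matroid_rank rk_loops; lia.
Qed.

Lemma alpha_modular i : i \notin K ->
  modular (fun k => alpha R k - (i \in pflat k)%:R).
Proof.
move=> iK; have sum_ind (A : {set E}) :
    \sum_(j in A) ((j == i)%:R : R) = (i \in A)%:R.
  have [iA|iA] := boolP (i \in A).
    by rewrite (bigD1 i) //= eqxx big1 ?addr0 // => j /andP[_ /negbTE ->].
  by rewrite big1 // => j jA; case: eqVneq => // ji; rewrite -ji jA in iA.
(* Uniform mass on the non-loops minus a unit mass at [i]; the total is 0 because [i] is a
   non-loop. *)
exists (fun j : E => #|[set: E] :\: K|%:R^-1 - (j == i)%:R).
  rewrite sumrB sumr_const -[_^-1 *+ _]mulr_natl divff ?card_nonloops_neq0 //.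
  by rewrite sum_ind in_setD iK in_setT subrr.
by move=> k; rewrite sumrB sumr_const -[_^-1 *+ _]mulr_natl sum_ind in_setD iK.
Qed.

Lemma beta_alpha k : beta R k = 1 - alpha R k.
Proof.
apply/eqP; rewrite eq_sym subr_eq eq_sym /alpha /beta -mulrDl -natrD.
rewrite -[X in _ == X](divff card_nonloops_neq0); apply/eqP; congr (_%:R / _).
have Kk : K \subset pflat k by rewrite proper_sub ?pflat_loops.
have := cardsID (pflat k) ([set: E] :\: K).
rewrite setIDAC setTI setDDl (setUidPr Kk); lia.
Qed.

Lemma dirderiv_alpha i T : i \notin K ->
  D_alpha \d_T = \sum_(k | i \in pflat k) (\d_T)^`M(k).
Proof.
move=> iK; have := dirderiv_modular T (alpha_modular iK).
rewrite dirderivB => /eqP; rewrite subr_eq0 => /eqP ->.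
rewrite /dirderiv [RHS]big_mkcond; apply: eq_bigr => k _.
by case: (i \in _); rewrite ?scale1r ?scale0r.
Qed.

Lemma dirderiv_beta i T : i \notin K ->
  D_beta \d_T = \sum_(k | i \notin pflat k) (\d_T)^`M(k).
Proof.
move=> iK; rewrite (eq_dirderiv _ beta_alpha) dirderivB (dirderiv_alpha _ iK).
rewrite /dirderiv (bigID (fun k => i \in pflat k)) /= addrAC.
under eq_bigr do rewrite scale1r.
rewrite subrr add0r; by apply: eq_bigr => k _; rewrite scale1r.
Qed.

(** A flat containing [i] cannot lie inside [G], so if it is comparable with the top it is strictly
    above; the other flats give non-chains and zero derivatives. *)
Lemma alpha_step i T G : i \notin K -> is_top T G -> i \notin G ->
  D_alpha \d_T = \sum_(k | (i \in pflat k) && (G \proper pflat k)) \d_(k |: T).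
Proof.
move=> iK [TG GT] iG; rewrite (dirderiv_alpha _ iK) big_mkcondr.
apply: eq_bigr => k ik.
(* Members of [T] lie in [G] and miss [i], so no variable is differentiated twice. *)
have kT : k \notin T by apply: contraNN iG => /TG/subsetP; apply.
rewrite partialU1 //; case: ifPn => // Gk; apply: partial_nonchain.
apply: contraNN Gk => /chainP chT.
suff Gk : G \subset pflat k by apply/properP; split=> //; exists i.
case: GT => [->|[j jT jG]]; first exact/proper_sub/pflat_loops.
have := chT j k; rewrite !in_setU1 jT eqxx orbT => /(_ isT isT).
by rewrite jG => /orP[//|/subsetP/(_ i ik)]; rewrite (negbTE iG).
Qed.

Lemma beta_step i T G : i \notin K -> is_bottom T G -> i \in G ->
  D_beta \d_T = \sum_(k | (i \notin pflat k) && (pflat k \proper G)) \d_(k |: T).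
Proof.
move=> iK [TG GT] iG; rewrite (dirderiv_beta _ iK) big_mkcondr.
apply: eq_bigr => k ik.
have kT : k \notin T by apply: contraNN ik => /TG/subsetP; apply.
rewrite partialU1 //; case: ifPn => // Gk; apply: partial_nonchain.
apply: contraNN Gk => /chainP chT.
suff Gk : pflat k \subset G by apply/properP; split=> //; exists i.
case: GT => [->|[j jT jG]]; first exact: subsetT.
have := chT j k; rewrite !in_setU1 jT eqxx orbT => /(_ isT isT).
by rewrite jG => /orP[/subsetP/(_ i iG)|//]; rewrite (negbTE ik).
Qed.

(** Each application raises the rank of the top, which never exceeds [d]. *)
Lemma alpha_vanish m T G : is_top T G -> (d - rk G < m)%N ->
  iter m D_alpha \d_T = 0.
Proof.
elim: m T G => // m IHm T G topG ltm; rewrite iterSr.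
have [i iK iG] := top_avoided rank_ge2 topG.
rewrite (alpha_step iK topG iG) iter_dirderiv_sum big1 // => k /andP[_ Gk].
apply: (IHm _ (pflat k)); first exact: topU1 topG Gk.
have := rk_flat_proper (top_flat topG) Gk; have := rk_pflat_le k; lia.
Qed.

(** Each application lowers the rank of the bottom, which stays positive, so at most [rk G - 1]
    applications survive. *)
Lemma beta_vanish m T G : is_bottom T G -> (rk G <= m)%N ->
  iter m D_beta \d_T = 0.
Proof.
elim: m T G => [|m IHm] T G botG ltm.
  by have := bottom_rk rank_ge2 botG; rewrite ltnNge ltm.
rewrite iterSr; have [i iK iG] := bottom_member rank_ge2 botG.
rewrite (beta_step iK botG iG) iter_dirderiv_sum big1 // => k /andP[_ kG].
apply: (IHm _ (pflat k)); first exact: bottomU1 botG kG.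
have := rk_flat_proper (pflat_flat k) kG; lia.
Qed.

(** The cardinality condition says that the chain meets every rank from 1 to [rk G]. Each step has
    one surviving extension, and the process ends at a maximal chain, where the derivative is 1. *)
Lemma alpha_saturated T G : is_chain T -> is_top T G -> #|T| = rk G ->
  iter (d - rk G) D_alpha \d_T = 1.
Proof.
move e : (d - rk G)%N => n; elim: n T G e => [|n IHn] T G e chT topG cT.
  apply: (vol_max_chain vol_is_vol); apply: max_chain => //.
  by have := top_rk topG; lia.
rewrite iterSr; have [i iK iG] := top_avoided rank_ge2 topG.
have fG := top_flat topG.
have [k0 k0E] : exists k : 'I_#|proper_flats M|, pflat k = closure M (i |: G).
  apply: pflat_exists; first exact: closure_flat.
  rewrite rk_closure rk_flatU1 //; lia.
have coverE k := flat_coverE fG (pflat_flat k) iG.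
rewrite (alpha_step iK topG iG) iter_dirderiv_sum (bigD1 k0) /=; last first.
  by have := coverE k0; rewrite k0E eqxx => /esym/and3P[-> ->].
have := coverE k0; rewrite k0E eqxx => /esym; rewrite -k0E => /and3P[ik0 Gk0 /eqP rk0].
rewrite (IHn _ (pflat k0)) ?big1 ?addr0 //.
(* Any other flat above [G] containing [i] skips a rank, leaving too few ranks for the remaining [n]
   applications. *)
- move=> k /andP[/andP[ik Gk] kk0]; apply: (@alpha_vanish _ _ (pflat k)).
    exact: topU1 topG Gk.
  have := coverE k; rewrite -k0E ik Gk (inj_eq (@pflat_inj _ _)) (negbTE kk0) /=.
  move=> /esym/negbT; have := rk_flat_proper fG Gk; have := rk_pflat_le k; lia.
- lia.
- exact: chainU1_top topG Gk0.
- exact: topU1 topG Gk0.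
rewrite cardsU1 cT rk0; case: (boolP (k0 \in T)) => // /(proj1 topG)/subsetP/(_ _ ik0).
by rewrite (negbTE iG).
Qed.

(** Here the chain meets every rank from [rk G] to [rk H]. Each [D_beta] prepends the coatoms
    avoiding [i], matching the recursion for the absolute Moebius values, until the bottom has rank
    one and [alpha_saturated] applies. *)
Lemma alpha_beta_saturated T G H : is_chain T -> T != set0 ->
  is_bottom T G -> is_top T H -> (#|T| + rk G = (rk H).+1)%N ->
  iter (d - rk H) D_alpha (iter (rk G).-1 D_beta \d_T) = (`|mobius M K G|%N)%:R.
Proof.
move e : (rk G).-1 => n; elim: n T G e => [|n IHn] T G e chT T0 botG topH cT.
  have rG : rk G = 1%N by have := bottom_rk rank_ge2 botG; lia.
  rewrite absz_mobius_rk1 ?(bottom_flat botG) // alpha_saturated //; lia.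
have rG : rk G = n.+2 by lia.
have [i iK iG] := bottom_member rank_ge2 botG.
rewrite iterSr (beta_step iK botG iG) iter_dirderiv_sum iter_dirderiv_sum.
rewrite (absz_mobius_coatoms (bottom_flat botG) iG iK) natr_sum.
(* A flat below [G] that is not a coatom has rank at most [n], too low for the [n] remaining
   [D_beta]. *)
rewrite (bigID (fun k => rk (pflat k) == n.+1)) /= [X in _ + X]big1 ?addr0; last first.
  move=> k /andP[/andP[ik kG] rk_k].
  rewrite (@beta_vanish _ _ (pflat k)) ?iter_dirderiv0 //.
    exact: bottomU1 botG kG.
  have := rk_flat_proper (pflat_flat k) kG; lia.
transitivity (\sum_(k : 'I_#|proper_flats M| | pflat k \in coatoms_avoiding M i G)
    (`|mobius M K (pflat k)|%N)%:R : {mpoly R[#|proper_flats M|]}).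
  apply: eq_big => [k|k /andP[/andP[ik kG] /eqP rk_k]].
    by rewrite [in RHS]inE pflat_flat rG eqSS [RHS]/= andbA [n.+1 == _]eq_sym.
  apply: IHn.
  - by rewrite rk_k.
  - exact: chainU1_bottom botG kG.
  - by apply/set0Pn; exists k; apply: setU11.
  - exact: bottomU1 botG kG.
  - exact: topU1_below topH botG T0 kG.
  - rewrite cardsU1 rk_k; case: (boolP (k \in T)) => [kT|_]; last lia.
    by case/negP: ik; apply: (subsetP (proj1 botG _ kT)).
rewrite (sum_pflat M (fun F => F \in coatoms_avoiding M i G)
  (fun F => (`|mobius M K F|%N)%:R)).
apply: eq_bigl => F; rewrite proper_flatsE andb_idl // [in X in X -> _]inE.
case/and4P=> fF _ _; rewrite fF rG eqSS => /eqP <- /=.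
have := rkS M (bottom_sub_top botG topH T0); have := top_rk topH; lia.
Qed.

(** Start from the empty chain and spend the first [D_beta] on the prescribed [i]; later steps
    choose their own non-loops. For [b = 0] only [K] contributes. *)
Lemma alpha_beta_vol i b : i \notin K -> (b <= d)%N ->
  iter (d - b) D_alpha (iter b D_beta vol)
  = (\sum_(F in flats M | [&& F \proper [set: E], i \notin F & rk F == b])
      `|mobius M K F|)%N%:R.
Proof.
move=> iK; have bot0 : is_bottom (set0 : {set 'I_#|proper_flats M|}) [set: E].
  by split=> [j|]; [rewrite in_set0|left].
have top0 : is_top (set0 : {set 'I_#|proper_flats M|}) K.
  by split=> [j|]; [rewrite in_set0|left].
have ch0 : is_chain (set0 : {set 'I_#|proper_flats M|}).
  by apply/chainP => j; rewrite in_set0.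
rewrite -{1}partial0; case: b => [|b] bd.
  have := alpha_saturated ch0 top0; rewrite cards0 rk_loops => -> //.
  rewrite (big_pred1 K) ?mobiusE ?eqxx // => F.
  apply/and4P/eqP => [[fF _ _]|->]; first by rewrite rk_flat_eq0 // => /eqP.
  rewrite loops_flat iK rk_loops properT; split=> //.
  by apply/negP => /eqP KE; move: iK; rewrite KE inE.
rewrite iterSr (beta_step iK bot0) ?inE // !iter_dirderiv_sum natr_sum.
rewrite (bigID (fun k => rk (pflat k) == b.+1)) /= [X in _ + X]big1 ?addr0; last first.
  (* Ranks at most [b] die under the remaining [D_beta]; ranks above [b.+1] die under [D_alpha],
     once the operators are swapped. *)
  move=> k /andP[/andP[_ kE] rk_k]; have [ltb|geb] := leqP (rk (pflat k)) b.
    rewrite (@beta_vanish _ _ (pflat k)) ?iter_dirderiv0 //.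
    exact: bottomU1 bot0 kE.
  rewrite iter_dirderivC (@alpha_vanish _ _ (pflat k)) ?iter_dirderiv0 //.
    exact: topU1 top0 (pflat_loops k).
  have := rk_pflat_le k; lia.
pose P F := [&& F \proper [set: E], i \notin F & rk F == b.+1].
transitivity (\sum_(k : 'I_#|proper_flats M| | P (@pflat E M k))
    (`|mobius M K (pflat k)|%N)%:R : {mpoly R[#|proper_flats M|]}).
  apply: eq_big => [k|k /andP[/andP[ik kE] /eqP rk_k]].
    by rewrite /P andbCA andbA.
  have := @alpha_beta_saturated (k |: set0) (pflat k) (pflat k).
  rewrite rk_k; apply.
  - exact: chainU1_bottom bot0 kE.
  - by apply/set0Pn; exists k; apply: setU11.
  - exact: bottomU1 bot0 kE.
  - exact: topU1 top0 (pflat_loops k).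
  - by rewrite setU0 cards1.
rewrite (sum_pflat M P (fun F => (`|mobius M K F|%N)%:R)).
apply: eq_bigl => F; rewrite proper_flatsE -andbA; congr (_ && _).
by rewrite andb_idl // => /and3P[_ _ /eqP ->].
Qed.

End VolumeDerivatives.

(** * Comparison of coefficients in the two variables *)

Theorem theorem4p9 (R : realFieldType) (E : finType) (M : matroid E)
    (hr : (2 <= matroid_rank M)%N) (i : E) (hi : i \notin loops M)
    (vol : {mpoly R[#|proper_flats M|]}) (hvol : is_vol vol) :
  let s : {mpoly R[2]} := 'X_0 in
  let t : {mpoly R[2]} := 'X_1 in
  ((lattice_dim M)`!)%:R *:
    (vol \mPo [tuple alpha R k *: s + beta R k *: t | k < #|proper_flats M|])
  = \sum_(F in flats M | [&& loops M \subset F, F \proper [set: E] & i \notin F])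
      (('C(lattice_dim M, int_rank M (loops M) F)
          * `|mobius M (loops M) F|)%N)%:R
      *: (t ^+ int_rank M (loops M) F * s ^+ int_dim M F [set: E]).
Proof.
move=> s t; set lq := mktuple _; set d := lattice_dim M.
(* The exponent of [t ^+ b * s ^+ (d - b)]; these are all the monomials of degree [d]. *)
pose mon b : 'X_{1..2} := (U_(1%R) *+ b + U_(0%R) *+ (d - b))%MM.
have mon1 b : mon b 1 = b.
  by rewrite mnmDE !mulmnE !mnm1E /= mul1n mul0n addn0.
have mdeg_mon b : (b <= d)%N -> mdeg (mon b) = d.
  by move=> bd; rewrite mdegD !mdegMn !mdeg1 !mul1n subnKC.
have monE m : mdeg m = d -> m = mon (m 1).
  rewrite mdegE !big_ord_recl big_ord0 addn0 => md.
  apply/mnmP => k; rewrite mnmDE !mulmnE !mnm1E.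
  have [->|->] : k = 0 \/ k = 1.
    by case: k => [[|[|//]] k2]; [left|right]; apply: val_inj.
    rewrite /= mul0n mul1n add0n -md.
    have -> : lift ord0 ord0 = 1 :> 'I_2 by apply: val_inj.
    by rewrite addnK.
  by rewrite /= mul0n mul1n addn0.
have rkd F : F \in flats M -> F \proper [set: E] -> (rk M F <= d)%N.
  move=> fF /(rk_flat_proper fF); rewrite /d /lattice_dim /matroid_rank; lia.
have -> : \sum_(F in flats M |
      [&& loops M \subset F, F \proper [set: E] & i \notin F])
      (('C(d, int_rank M (loops M) F) * `|mobius M (loops M) F|)%N)%:R
      *: (t ^+ int_rank M (loops M) F * s ^+ int_dim M F [set: E])
    = \sum_(F in flats M | (F \proper [set: E]) && (i \notin F))
      (('C(d, rk M F) * `|mobius M (loops M) F|)%N)%:R *: 'X_[mon (rk M F)].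
  apply: eq_big => [F|F _].
    by case fF: (F \in flats M); rewrite // loops_min.
  rewrite /int_rank /int_dim /int_rank rk_loops subn0 mpolyXD -!mpolyXn.
  congr (_ *: (_ * _ ^+ _)).
  by rewrite /d /lattice_dim /matroid_rank -!subnDA addnC.
apply/mpolyP => m; rewrite mcoeffZ [RHS]raddf_sum /=.
under eq_bigr do rewrite mcoeffZ mcoeffX.
(* Outside degree [d] both sides vanish, the left one by homogeneity of [vol]. *)
have [md|md] := eqVneq (mdeg m) d; last first.
  have hom_lq : vol \mPo lq \is d.-homog.
    apply: dhomog_comp_mpoly => [|k]; first exact: (vol_homog hvol).
    by rewrite tnth_mktuple rpredD //; apply: dhomogZ; rewrite dhomogX /= mdeg1.
  rewrite (dhomog_nemf_coeff hom_lq md) mulr0.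
  rewrite big1 // => F /and3P[fF FE _].
  have [e|_] := eqVneq (mon (rk M F)) m; last by rewrite mulr0.
  by move: md; rewrite -e mdeg_mon ?eqxx // rkd.
rewrite (monE m md); move: (m 1) (monE m md) => b mb.
have bd : (b <= d)%N.
  by move: md; rewrite mb mdegD !mdegMn !mdeg1; lia.
have := mcoeff_comp_linear (@alpha R E M) (@beta R E M) vol (d - b) b.
rewrite (alpha_beta_vol hr hvol hi bd) -/lq -/(mon b).
rewrite -mpolyC_nat comp_mpolyC mcoeffC eqxx mulr1 => coeffE.
(* Writing the factorial of [d] as a binomial times two factorials lets the latter absorb the Taylor
   denominators. *)
rewrite -(bin_fact bd) natrM -mulrA [X in _ * X]mulr_natl coeffE -natrM big_distrr.
rewrite natr_sum big_mkcond [RHS]big_mkcond; apply: eq_bigr => F _ /=.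
have -> : (mon (rk M F) == mon b) = (rk M F == b).
  by apply/eqP/eqP => [/(congr1 (fun m' : 'X_{1..2} => m' 1))|->//]; rewrite !mon1.
have [->|_] := eqVneq (rk M F) b; first by rewrite mulr1 andbT.
by rewrite mulr0 !andbF if_same.
Qed.
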